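(* Let $\delta\in\mathbb{C}$ and let $m,n \in \mathbb{N}$ with $n \geq 1$. Let $(x_{i,m}^{(\delta)})_{i}$ be the repeated sequence of order $m$ with constant $m$-th difference $\delta$. Then $$x_{n,m}^{(\delta)}=\Delta^{m}x_{n,m}^{(\delta)} \binom{n+m-1}{m}=\delta \binom{n+m-1}{m}.$$
   Context: $\mathbb{N}=\{0,1,2,\dots\}$. For a complex sequence $(x_i)_{i\in\mathbb{Z}}$, the $m$-th difference is defined by $\Delta^0 x_i = x_i$ for all $i\in\mathbb{Z}$ and $\Delta^{m} x_{i} = \Delta^{m-1} x_{i} - \Delta^{m-1} x_{i-1}$ for $m\geq 1$. For $\delta\in\mathbb{C}$ and $m\in\mathbb{N}$, the repeated sequence of order $m$ with $m$-th difference $\delta$, denoted $(x_{i,m}^{(\delta)})$, is the sequence indexed by $i \in\mathbb{Z}$ such that $x_{i,m}^{(\delta)}=0$ for all $i\leq 0$ and $\Delta^m x_{i,m}^{(\delta)}=\delta$ for all integers $i\geq 1$ (here $\Delta^m$ acts on the index $i$); it is unique. *)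

(* Defs.v *)
From HB Require Import structures.
From mathcomp Require Import all_boot all_order all_algebra.
From mathcomp Require Import reals complex.

Set Implicit Arguments.
Unset Strict Implicit.
Unset Printing Implicit Defensive.

Import Order.TTheory GRing.Theory Num.Theory.
Local Open Scope ring_scope.

Fixpoint bwd_diff (V : zmodType) (m : nat) (x : int -> V) (i : int) : V :=
  if m is k.+1 then bwd_diff k x i - bwd_diff k x (i - 1) else x i.

Definition repeated_seq (V : zmodType) (m : nat) (delta : V) (x : int -> V)
    : Prop :=
  (forall i : int, i <= 0 -> x i = 0) /\
  (forall i : int, 1 <= i -> bwd_diff m x i = delta).

Lemma bwd_diff_le0 (V : zmodType) (m : nat) (x : int -> V) :
  (forall i, i <= 0 -> x i = 0) -> forall i, i <= 0 -> bwd_diff m x i = 0.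
Proof.
move=> x0; elim: m => [|m IHm] i i_le0 /=; first exact: x0.
by rewrite !IHm ?subrr // lerBlDr (le_trans i_le0).
Qed.

Lemma repeated_seq_unique (V : zmodType) (m : nat) (delta : V)
    (x y : int -> V) :
  repeated_seq m delta x -> repeated_seq m delta y -> x =1 y.
Proof.
move=> [x0 xd] [y0 yd].
have: bwd_diff m x =1 bwd_diff m y.
  move=> i; have [i_le0|i_gt0] := leP i 0; first by rewrite !bwd_diff_le0.
  by rewrite xd ?yd.
elim: m {xd yd} => [//|m IHm] /= eq_xy; apply: IHm => i.
have [i_le0|] := leP i 0; first by rewrite !bwd_diff_le0.
case: i => // n _; elim: n => [|n IHn]; first by rewrite !bwd_diff_le0.
have := eq_xy n.+1; have -> : n.+1%:Z - 1 = n by rewrite -addn1 PoszD addrK.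
by rewrite IHn => /addIr.
Qed.

Lemma repeated_seq_exists (V : zmodType) (m : nat) (delta : V) :
  exists x : int -> V, repeated_seq m delta x.
Proof.
elim: m => [|m [x [x0 xd]]].
  exists (fun i => if i <= 0 then 0 else delta); split=> [i -> //|i i_ge1 /=].
  by rewrite leNgt (lt_le_trans _ i_ge1).
pose s (i : int) := if i is Posz n then \sum_(k < n.+1) x k%:Z else 0.
have sB i : s i - s (i - 1) = x i.
  case: i => [[|n]|n].
  - by rewrite /= big_ord1 subr0.
  - have -> : n.+1%:Z - 1 = n by rewrite -addn1 PoszD addrK.
    by rewrite addrC /s [X in _ + X]big_ord_recr addKr.
  - by rewrite x0 //= subr0.
have dS k i : bwd_diff k.+1 s i = bwd_diff k x i.
  elim: k i => [|k IHk] i; first exact: sB.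
  by rewrite -[LHS]/(bwd_diff k.+1 s i - bwd_diff k.+1 s (i - 1)) !IHk.
exists s; split=> [[[|n]|n] //= _|i i_ge1]; first by rewrite big_ord1 x0.
by rewrite dS xd.
Qed.

(* Main.v *)
Require Import Defs.
From HB Require Import structures.
From mathcomp Require Import all_boot all_order all_algebra.
From mathcomp Require Import reals complex.

Set Implicit Arguments.
Unset Strict Implicit.
Unset Printing Implicit Defensive.

Import Order.TTheory GRing.Theory Num.Theory.
Local Open Scope ring_scope.

(** Taking one backward difference of the repeated sequence of order [m + 1]
    yields the repeated sequence of order [m] with the same constant
    ([repeated_seq_diff]).  A sequence vanishing at 0 is the running sum of its
    differences, so the sequence of order [m + 1] is obtained by summing the one
    of order [m]; on binomial coefficients this summation is Pascal's rule.  The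
    closed form ([repeated_seqE]) thus follows by induction on the order, and
    holds in any abelian group since only integer multiples of [delta] occur. *)

(** [bwd_diff] applies its last difference on the outside, whereas induction on
    the order removes the innermost one. *)
Lemma bwd_diffSr (V : zmodType) (m : nat) (x : int -> V) (i : int) :
  bwd_diff m.+1 x i = bwd_diff m (fun j => x j - x (j - 1)) i.
Proof. by elim: m i => [//|m IHm] i; rewrite [RHS]/= -!IHm. Qed.

Lemma repeated_seq_diff (V : zmodType) (m : nat) (delta : V) (x : int -> V) :
  repeated_seq m.+1 delta x ->
  repeated_seq m delta (fun i => x i - x (i - 1)).
Proof.
move=> [x0 xd]; split=> i hi; last by rewrite -bwd_diffSr xd.
by rewrite !x0 ?subrr // lerBlDr (le_trans hi).
Qed.

(** The index is shifted to [n + 1] because the formula fails at index 0 when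
    [m = 0]: there the sequence vanishes but the truncated binomial is 1. *)
Lemma repeated_seqE (V : zmodType) (m : nat) (delta : V) (x : int -> V)
    (n : nat) :
  repeated_seq m delta x -> x n.+1%:Z = delta *+ 'C(n + m, m).
Proof.
elim: m x n => [|m IHm] x n hx; first by rewrite bin0; apply: hx.2.
have step k : x k.+1%:Z = delta *+ 'C(k + m, m) + x k%:Z.
  rewrite -(IHm _ _ (repeated_seq_diff hx)).
  have -> : k.+1%:Z - 1 = k by rewrite -addn1 PoszD addrK.
  by rewrite subrK.
elim: n => [|n IHn]; rewrite step; first by rewrite hx.1 // addr0 !add0n !binn.
by rewrite IHn -mulrnDr addSn [in RHS]addSn binS addnS addnC.
Qed.

Theorem theorem3p5 (R : realType) (delta : R[i]) (m n : nat) (hn : (1 <= n)%N)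
    (x : int -> R[i]) (hx : repeated_seq m delta x) :
  x n%:Z = bwd_diff m x n%:Z * 'C(n + m - 1, m)%:R /\
  bwd_diff m x n%:Z * 'C(n + m - 1, m)%:R = delta * 'C(n + m - 1, m)%:R.
Proof.
case: n hn => [//|n] _; rewrite addSn subn1 /= hx.2 //; split=> //.
by rewrite mulr_natr (repeated_seqE _ hx).
Qed.
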